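(* Let $n\ge 2$ be an integer, let $P_1(\theta)=A_1^1\cos\theta+B_1^1\sin\theta$ with real $A_1^1,B_1^1$ satisfying $(A_1^1)^2+(B_1^1)^2\neq 0$, and let $P_n(\theta)=\sum_{i+j=n}p_{ij}\cos^i\theta\,\sin^j\theta$ with real coefficients $p_{ij}$. If $r=0$ is a center of the equation $$\frac{dr}{d\theta}=r\left(P_1(\theta)\,r+P_n(\theta)\,r^n\right),$$ then this equation satisfies the Composition Condition: there exist a $2\pi$-periodic differentiable function $u(\theta)$ and continuous functions $\hat A_1,\hat A_2$ such that $$P_1(\theta)=u'(\theta)\,\hat A_1(u(\theta)),\qquad P_n(\theta)=u'(\theta)\,\hat A_2(u(\theta)).$$
   Context: For a scalar differential equation $\frac{dr}{d\theta}=F(\theta,r)$ with $F$ $2\pi$-periodic in $\theta$ and $F(\theta,0)\equiv 0$, we say that $r=0$ is a center if all solutions $r(\theta)$ close to the solution $r\equiv 0$ are $2\pi$-periodic, i.e. satisfy $r(2\pi)=r(0)$. *)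

(* Defs.v *)
From Stdlib Require Import Reals.
From Coquelicot Require Import Coquelicot.
Open Scope R_scope.

(** [r] solves dr/dtheta = F(theta, r) on [0, 2 PI].  Two-sided derivatives at
    the end points lose nothing: a solution on the closed interval with one-sided
    derivatives there extends affinely to a total function satisfying this. *)
Definition solution_on_period (F : R -> R -> R) (r : R -> R) : Prop :=
  forall theta, 0 <= theta <= 2 * PI -> is_derive r theta (F theta (r theta)).

(** Meant for [F] that is 2 PI-periodic in its first argument and vanishes for
    zero second argument.  The solutions range over those that stay close to 0 on
    one period; closeness on the whole line would exclude the spiralling solutions
    that a center has to rule out. *)
Definition is_center (F : R -> R -> R) : Prop :=
  exists delta, 0 < delta /\
    forall r : R -> R,
      solution_on_period F r ->
      (forall theta, 0 <= theta <= 2 * PI -> Rabs (r theta) < delta) ->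
      r (2 * PI) = r 0.

(** The composition condition for the pair of coefficients [P], [Q].  The outer
    functions are total; as [u] has compact interval range, a continuous function
    on that range extends continuously to the line. *)
Definition composition_condition (P Q : R -> R) : Prop :=
  exists u A1 A2 : R -> R,
    (forall theta, u (theta + 2 * PI) = u theta) /\
    (forall theta, ex_derive u theta) /\
    (forall x, continuous A1 x) /\
    (forall x, continuous A2 x) /\
    (forall theta, P theta = Derive u theta * A1 (u theta)) /\
    (forall theta, Q theta = Derive u theta * A2 (u theta)).

Definition linear_trig (a b : R) (theta : R) : R :=
  a * cos theta + b * sin theta.

(** The sum over i + j = n, parametrized by i = 0, ..., n ([sum_f_R0 _ n] has
    n + 1 terms). *)
Definition homogeneous_trig (n : nat) (p : nat -> nat -> R) (theta : R) : R :=
  sum_f_R0 (fun i => p i (n - i)%nat * cos theta ^ i * sin theta ^ (n - i)) n.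

(* Main.v *)
Require Import Defs.
From Stdlib Require Import Reals Lra Lia Psatz ZArith.
From Coquelicot Require Import Coquelicot.
Open Scope R_scope.

(** Let v be the periodic primitive of w = P_1, let r be a small positive
    solution, and put z = 1/r + v.  Then z' = - P_n r^(n-1), so z^n has derivative
    - n P_n (1 - v/z)^(-(n-1)); since z is periodic, the integral of
    P_n (1 - v/z)^(-(n-1)) over a period vanishes.  With a = 1/z(0) one has
    1/z = a + O(a^(n+1)), so the integral of P_n (1 - a v)^(-(n-1)) is
    O(a^(n+1)), and expanding in powers of a gives vanishing moments: the integral
    of P_n v^k is 0 for all k <= n.  On the other hand, v^2 + w^2 being constant,
    P_n = H(v) + w K(v) with polynomials H, K and deg H <= n.  Integrating
    P_n H(v), where w K(v) H(v) contributes nothing, yields a vanishing integral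
    of H(v)^2; hence H(v) = 0 and P_n = v' K(v). *)

(** * Projection onto an interval, continuity and integral estimates *)

(** For a <= b, the nearest-point projection onto [a, b]. It serves twice: to stop the time variable
    in the Picard map and to truncate the right-hand side of the equation. *)
Definition clamp (a b t : R) : R := Rmax a (Rmin b t).

Lemma clamp_in (a b t : R) : a <= b -> a <= clamp a b t <= b.
Proof.
  intros Hab; unfold clamp, Rmax, Rmin.
  destruct (Rle_dec b t); destruct (Rle_dec a _); lra.
Qed.

Lemma clamp_id (a b t : R) : a <= t <= b -> clamp a b t = t.
Proof.
  intros H; unfold clamp, Rmax, Rmin.
  destruct (Rle_dec b t); destruct (Rle_dec a _); lra.
Qed.

Lemma clamp_nonexpansive (a b s t : R) :
  Rabs (clamp a b s - clamp a b t) <= Rabs (s - t).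
Proof.
  unfold clamp, Rmax, Rmin.
  destruct (Rle_dec b t); destruct (Rle_dec b s);
    repeat destruct (Rle_dec a _); unfold Rabs;
    repeat destruct (Rcase_abs _); lra.
Qed.

Lemma lipschitz_continuous (f : R -> R) (K : R) :
  (forall s t, Rabs (f s - f t) <= K * Rabs (s - t)) ->
  forall t, continuous f t.
Proof.
  intros H t.
  assert (HK : 0 <= K).
  { generalize (H 1 0) (Rabs_pos (f 1 - f 0)).
    replace (1 - 0) with 1 by ring; rewrite Rabs_R1; lra. }
  apply continuity_pt_filterlim, continuity_pt_locally; intros eps.
  assert (Hd : 0 < eps / (K + 1)).
  { apply Rdiv_lt_0_compat; [apply cond_pos | lra]. }
  exists (mkposreal _ Hd); intros s Hs.
  change (Rabs (s - t) < eps / (K + 1)) in Hs.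
  apply Rle_lt_trans with (1 := H s t).
  apply (Rmult_lt_compat_l (K + 1)) in Hs; [|lra].
  replace ((K + 1) * (eps / (K + 1))) with (pos eps) in Hs by (field; lra).
  generalize (Rabs_pos (s - t)); lra.
Qed.

Lemma RInt_le_abs (f : R -> R) (a b M : R) :
  (forall t, Rmin a b <= t <= Rmax a b -> continuous f t) ->
  (forall t, Rmin a b <= t <= Rmax a b -> Rabs (f t) <= M) ->
  Rabs (RInt f a b) <= M * Rabs (b - a).
Proof.
  intros Hc HM; rewrite Rmult_comm.
  apply (norm_RInt_le_const_abs f a b (RInt f a b) M HM).
  apply (@RInt_correct R_CompleteNormedModule), ex_RInt_continuous, Hc.
Qed.

Lemma ex_RInt_cont (f : R -> R) (a b : R) :
  (forall t, continuous f t) -> ex_RInt f a b.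
Proof. intros H; apply (@ex_RInt_continuous R_CompleteNormedModule); auto. Qed.

Lemma is_lim_seq_le_const (u : nat -> R) (l M : R) (m : nat) :
  is_lim_seq u l -> (forall k, u (k + m)%nat <= M) -> l <= M.
Proof.
  intros Hl HM.
  apply (is_lim_seq_le (fun k => u (k + m)%nat) (fun _ => M) l M HM).
  - apply (is_lim_seq_incr_n u m), Hl.
  - apply is_lim_seq_const.
Qed.

(** * Picard iteration for a bounded, globally Lipschitz right-hand side *)

Section Picard.

Variables (F : R -> R -> R) (a b L K c : R).
(** The bound on L (b - a) makes the Picard map contract uniform distances by the factor 1/2.
    Continuity of F is asked along continuous curves, the form in which it enters the integrals. *)
Hypotheses (Ha : a < 0) (Hb : 0 < b) (HL : 0 <= L) (HLab : L * (b - a) <= / 2).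
Hypothesis HFc : forall y : R -> R, (forall t, continuous y t) ->
  forall t, continuous (fun s => F s (y s)) t.
Hypothesis HFK : forall t x, Rabs (F t x) <= K.
Hypothesis HFL : forall t x y, Rabs (F t x - F t y) <= L * Rabs (x - y).

(* Freezing the upper limit of integration outside [a, b] makes the contraction
   estimate uniform on the whole line. *)
Let T (y : R -> R) (t : R) : R := c + RInt (fun s => F s (y s)) 0 (clamp a b t).

Fixpoint picard_iter (m : nat) : R -> R :=
  match m with O => fun _ => c | S m => T (picard_iter m) end.

Let D := K * (b - a).

Let HK : 0 <= K.
Proof. generalize (HFK 0 0) (Rabs_pos (F 0 0)); lra. Qed.

Let clamp_ab (t : R) : Rabs (clamp a b t - 0) <= b - a.
Proof.
  destruct (clamp_in a b t); [lra|].
  apply Rabs_le; lra.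
Qed.

(** The constant K is the same for every y, so all iterates share it. It therefore passes to their
    pointwise limit, which gives the continuity of the limit. *)
Lemma picard_map_lipschitz (y : R -> R) : (forall t, continuous y t) ->
  forall s t, Rabs (T y s - T y t) <= K * Rabs (s - t).
Proof.
  intros Hy s t; unfold T.
  assert (HC := HFc y Hy).
  rewrite <- (RInt_Chasles (fun s => F s (y s)) 0 (clamp a b t) (clamp a b s))
    by (apply ex_RInt_cont; auto).
  unfold plus; simpl.
  assert (E : forall x z : R, c + (x + z) - (c + x) = z) by (intros; ring).
  rewrite E; clear E.
  eapply Rle_trans; [apply RInt_le_abs; auto|].
  apply Rmult_le_compat_l; [apply HK | apply clamp_nonexpansive].
Qed.

Lemma picard_map_contraction (y z : R -> R) (d : R) :
  (forall t, continuous y t) -> (forall t, continuous z t) ->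
  (forall t, Rabs (y t - z t) <= d) ->
  forall t, Rabs (T y t - T z t) <= d / 2.
Proof.
  intros Hy Hz Hd t; unfold T.
  assert (H := RInt_minus (fun s => F s (y s)) (fun s => F s (z s)) 0 (clamp a b t)
    (ex_RInt_cont _ _ _ (HFc y Hy)) (ex_RInt_cont _ _ _ (HFc z Hz))).
  unfold minus, plus, opp in H; simpl in H.
  assert (E : forall x z : R, c + x - (c + z) = x + - z) by (intros; ring).
  rewrite E, <- H; clear E.
  assert (Hd0 : 0 <= d) by (generalize (Hd 0) (Rabs_pos (y 0 - z 0)); lra).
  apply Rle_trans with (L * d * Rabs (clamp a b t - 0)).
  - apply RInt_le_abs.
    + intros s _; apply (continuous_minus (fun s => F s (y s)) (fun s => F s (z s)));
        apply HFc; auto.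
    + intros s _; eapply Rle_trans; [apply HFL|].
      apply Rmult_le_compat_l; auto.
  - apply Rle_trans with (L * d * (b - a)).
    + apply Rmult_le_compat_l; [apply Rmult_le_pos; auto | apply clamp_ab].
    + nra.
Qed.

Lemma picard_iter_lipschitz (m : nat) (s t : R) :
  Rabs (picard_iter m s - picard_iter m t) <= K * Rabs (s - t).
Proof.
  revert s t; induction m as [|m IH]; intros s t; simpl.
  - rewrite Rminus_diag, Rabs_R0.
    apply Rmult_le_pos; [apply HK | apply Rabs_pos].
  - apply picard_map_lipschitz; intros u.
    apply (lipschitz_continuous _ K), IH.
Qed.

Lemma picard_iter_continuous (m : nat) (t : R) : continuous (picard_iter m) t.
Proof. apply (lipschitz_continuous _ K), picard_iter_lipschitz. Qed.

Lemma picard_iter_step (m : nat) (t : R) :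
  Rabs (picard_iter (S m) t - picard_iter m t) <= D / 2 ^ m.
Proof.
  revert t; induction m as [|m IH]; intros t.
  - simpl; unfold T.
    rewrite Rplus_minus_l.
    eapply Rle_trans; [apply (RInt_le_abs _ _ _ K)|].
    + intros s _; apply HFc, (picard_iter_continuous 0).
    + intros; apply HFK.
    + unfold D; rewrite Rdiv_1_r.
      apply Rmult_le_compat_l; [apply HK | apply clamp_ab].
  - replace (D / 2 ^ S m) with (D / 2 ^ m / 2)
      by (simpl; field; apply pow_nonzero; lra).
    apply (picard_map_contraction (picard_iter (S m)) (picard_iter m));
      try apply picard_iter_continuous; exact IH.
Qed.

(** The subtracted tail makes the bound telescope, so that the induction on k closes;
    [picard_iter_close] then drops it. *)
Lemma picard_iter_cauchy (m k : nat) (t : R) :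
  Rabs (picard_iter (k + m) t - picard_iter m t) <= 2 * D / 2 ^ m - 2 * D / 2 ^ (k + m).
Proof.
  induction k as [|k IH].
  - simpl; rewrite !Rminus_diag, Rabs_R0; lra.
  - replace (picard_iter (S k + m) t - picard_iter m t) with
      ((picard_iter (S (k + m)) t - picard_iter (k + m) t)
       + (picard_iter (k + m) t - picard_iter m t)) by (simpl; ring).
    eapply Rle_trans; [apply Rabs_triang|].
    generalize (picard_iter_step (k + m) t).
    replace (2 * D / 2 ^ (S k + m)) with (D / 2 ^ (k + m))
      by (simpl; field; apply pow_nonzero; lra).
    lra.
Qed.

Lemma picard_iter_close (m k : nat) (t : R) :
  Rabs (picard_iter (k + m) t - picard_iter m t) <= 2 * D / 2 ^ m.
Proof.
  eapply Rle_trans; [apply picard_iter_cauchy|].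
  assert (0 <= 2 * D / 2 ^ (k + m)); [|lra].
  apply Rdiv_le_0_compat; [|apply pow_lt; lra].
  unfold D; generalize (Rmult_le_pos K (b - a)) HK; lra.
Qed.

Lemma geometric_small (C : R) (eps : posreal) :
  exists m : nat, C / 2 ^ m < eps.
Proof.
  assert (H : is_lim_seq (fun m => C * (/ 2) ^ m) (C * 0)).
  { apply (is_lim_seq_scal_l _ C 0), is_lim_seq_geom.
    rewrite Rabs_pos_eq; lra. }
  rewrite Rmult_0_r in H.
  apply is_lim_seq_spec in H.
  destruct (H eps) as [m Hm]; exists m.
  specialize (Hm m (le_n m)); rewrite pow_inv, Rminus_0_r in Hm.
  apply Rle_lt_trans with (2 := Hm), Rle_abs.
Qed.

Lemma picard_iter_cvg (t : R) : ex_finite_lim_seq (fun m => picard_iter m t).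
Proof.
  apply ex_lim_seq_cauchy_corr; intros eps.
  destruct (geometric_small (4 * D) eps) as [N HN].
  exists N; intros i j Hi Hj.
  assert (H1 := picard_iter_close N (i - N) t).
  assert (H2 := picard_iter_close N (j - N) t).
  replace (i - N + N)%nat with i in H1 by lia.
  replace (j - N + N)%nat with j in H2 by lia.
  replace (4 * D / 2 ^ N) with (2 * (2 * D / 2 ^ N)) in HN
    by (field; apply pow_nonzero; lra).
  replace (picard_iter i t - picard_iter j t) with
    ((picard_iter i t - picard_iter N t) - (picard_iter j t - picard_iter N t)) by ring.
  apply Rle_lt_trans with (2 := HN).
  unfold Rminus at 1; eapply Rle_trans; [apply Rabs_triang|].
  rewrite Rabs_Ropp; lra.
Qed.

Let y (t : R) : R := real (Lim_seq (fun m => picard_iter m t)).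

Let y_lim (t : R) : is_lim_seq (fun m => picard_iter m t) (y t).
Proof. apply Lim_seq_correct', picard_iter_cvg. Qed.

Let y_continuous (t : R) : continuous y t.
Proof.
  apply (lipschitz_continuous _ K); clear t; intros s t.
  apply (is_lim_seq_le_const (fun m => Rabs (picard_iter m s - picard_iter m t)) _ _ 0).
  - apply (is_lim_seq_abs _ (y s - y t)), is_lim_seq_minus'; apply y_lim.
  - intros; apply picard_iter_lipschitz.
Qed.

Let y_close (m : nat) (t : R) : Rabs (y t - picard_iter m t) <= 2 * D / 2 ^ m.
Proof.
  apply (is_lim_seq_le_const (fun k => Rabs (picard_iter k t - picard_iter m t)) _ _ m).
  - apply (is_lim_seq_abs _ (y t - picard_iter m t)), is_lim_seq_minus';
      [apply y_lim | apply is_lim_seq_const].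
  - intros; apply picard_iter_close.
Qed.

(** Both [T y] and [y] lie within D / 2^m of the iterate of index m + 1: the first by contraction,
    the second by the geometric tail. *)
Let y_fixpoint (t : R) : T y t = y t.
Proof.
  apply Rminus_diag_uniq, Rabs_eq_0, Rle_antisym; [|apply Rabs_pos].
  apply le_epsilon; intros eps Heps; rewrite Rplus_0_l.
  destruct (geometric_small (2 * D) (mkposreal _ Heps)) as [m Hm]; simpl in Hm.
  assert (H1 := picard_map_contraction y (picard_iter m) _ y_continuous
    (picard_iter_continuous m) (y_close m) t).
  assert (H2 := y_close (S m) t).
  change (T (picard_iter m) t) with (picard_iter (S m) t) in H1.
  replace (2 * D / 2 ^ S m) with (2 * D / 2 ^ m / 2) in H2
    by (simpl; field; apply pow_nonzero; lra).
  replace (T y t - y t) with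
    ((T y t - picard_iter (S m) t) - (y t - picard_iter (S m) t)) by ring.
  unfold Rminus at 1; eapply Rle_trans; [apply Rabs_triang|].
  rewrite Rabs_Ropp; lra.
Qed.

(** Inside the open interval [clamp] is locally the identity, so the fixed-point equation can be
    differentiated. The bound on the displacement holds on the whole line because the fixed point is
    constant outside [a, b]. *)
Lemma picard : exists r : R -> R,
  r 0 = c /\
  (forall t, a < t < b -> is_derive r t (F t (r t))) /\
  (forall t, Rabs (r t - c) <= K * (b - a)).
Proof.
  exists y; split; [|split].
  - rewrite <- y_fixpoint; unfold T; rewrite clamp_id by lra.
    rewrite RInt_point; unfold zero; simpl; ring.
  - intros t Ht.
    apply (is_derive_ext_loc (fun t => c + RInt (fun s => F s (y s)) 0 t)).
    + apply (filter_imp (fun t => a < t < b)).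
      * intros u Hu; rewrite <- y_fixpoint; unfold T; rewrite clamp_id; [easy | lra].
      * apply filter_and; [apply (open_gt a) | apply (open_lt b)]; lra.
    + replace (F t (y t)) with (0 + F t (y t)) by ring.
      apply (is_derive_plus (fun _ => c)); [apply (@is_derive_const R_AbsRing)|].
      apply (is_derive_RInt (fun s => F s (y s)) _ 0).
      * apply filter_forall; intros u.
        apply (@RInt_correct R_CompleteNormedModule), ex_RInt_cont, HFc, y_continuous.
      * apply (HFc y y_continuous).
  - intros t; rewrite <- y_fixpoint; unfold T.
    rewrite Rplus_minus_l.
    eapply Rle_trans; [apply (RInt_le_abs _ _ _ K)|].
    + intros s _; apply HFc, y_continuous.
    + intros; apply HFK.
    + apply Rmult_le_compat_l; [apply HK | apply clamp_ab].
Qed.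

End Picard.

(** * Existence of small positive solutions over a full period *)

Lemma continuous_pow (f : R -> R) (n : nat) (t : R) :
  continuous f t -> continuous (fun s => f s ^ n) t.
Proof.
  intros Hf; induction n as [|n IH]; simpl.
  - apply continuous_const.
  - apply (continuous_mult f); auto.
Qed.

Lemma pow_le_bound (x K : R) (m : nat) : Rabs x <= K -> Rabs (x ^ m) <= K ^ m.
Proof. intros H; rewrite <- RPow_abs; apply pow_incr; split; [apply Rabs_pos | auto]. Qed.

Lemma pow_lipschitz (x y K : R) (m : nat) : Rabs x <= K -> Rabs y <= K ->
  Rabs (x ^ S m - y ^ S m) <= INR (S m) * K ^ m * Rabs (x - y).
Proof.
  intros Hx Hy; assert (HK : 0 <= K) by (generalize (Rabs_pos x); lra).
  induction m as [|m IH].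
  - simpl; rewrite !Rmult_1_r, Rmult_1_l; lra.
  - replace (x ^ S (S m) - y ^ S (S m)) with
      (x * (x ^ S m - y ^ S m) + y ^ S m * (x - y)) by (simpl; ring).
    eapply Rle_trans; [apply Rabs_triang|].
    rewrite !Rabs_mult, (S_INR (S m)).
    assert (H1 := pow_le_bound y K (S m) Hy).
    assert (H2 : Rabs x * Rabs (x ^ S m - y ^ S m)
       <= K * (INR (S m) * K ^ m * Rabs (x - y))).
    { apply Rmult_le_compat; auto; apply Rabs_pos. }
    assert (H3 : Rabs (y ^ S m) * Rabs (x - y) <= K ^ S m * Rabs (x - y)).
    { apply Rmult_le_compat_r; auto; apply Rabs_pos. }
    replace ((INR (S m) + 1) * K ^ S m * Rabs (x - y)) with
      (K * (INR (S m) * K ^ m * Rabs (x - y)) + K ^ S m * Rabs (x - y)) by (simpl; ring).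
    lra.
Qed.

Lemma two_PI_lt_9 : 2 * PI < 9.
Proof. generalize PI_4; lra. Qed.

(** Truncated to 0 <= x <= 2c, the right-hand side is O(c^2) with a Lipschitz constant O(c). For
    small c the truncated solution thus exists over the period and moves by at most c/2; it never
    reaches the truncation and solves the original equation. *)
Lemma small_solution (P Q : R -> R) (M : R) (m : nat)
  (hP : forall t, continuous P t) (hQ : forall t, continuous Q t)
  (hPM : forall t, Rabs (P t) <= M) (hQM : forall t, Rabs (Q t) <= M) :
  exists c0, 0 < c0 /\ forall c, 0 < c <= c0 -> exists r : R -> R,
    r 0 = c /\
    solution_on_period (fun t x => x * (P t * x + Q t * x ^ S m)) r /\
    (forall t, c / 2 <= r t <= 3 * c / 2).
Proof.
  assert (HM : 0 <= M) by (generalize (hPM 0) (Rabs_pos (P 0)); lra).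
  assert (Hm := pos_INR m).
  (* c N bounds the Lipschitz constant of the truncated right-hand side; M + 1 keeps N positive when
     M = 0. The factor 20 below gives c N <= 1/20, hence contraction factor 1/2 on an interval of
     length 10. *)
  set (N := (4 + 2 * (INR m + 2)) * (M + 1)).
  assert (HN : 8 * (M + 1) <= N) by (unfold N; nra).
  set (c0 := / (20 * N)).
  assert (Hc0 : c0 * (20 * N) = 1) by (unfold c0; field; lra).
  assert (Hc0p : 0 < c0) by (apply Rinv_0_lt_compat; lra).
  exists c0; split; [exact Hc0p|].
  intros c Hc.
  assert (HcN : c * N <= / 20) by nra.
  assert (Hc2 : 2 * c <= 1) by nra.
  set (F := fun t x => let z := clamp 0 (2 * c) x in z * (P t * z + Q t * z ^ S m)).
  assert (Hcl : forall x, 0 <= clamp 0 (2 * c) x <= 2 * c)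
    by (intros; apply clamp_in; lra).
  (* The open interval from -1 to 9 contains [0, 2 PI], so two-sided derivatives exist at both end
     points. The bound 8 M c^2 is 2M times (2c)^2. *)
  destruct (picard F (-1) 9 (c * N) (8 * M * c * c) c) as (r & Hr0 & Hr & Hrc);
    try lra; try nra.
  - intros y Hy t; unfold F; simpl.
    assert (Hz : continuous (fun s => clamp 0 (2 * c) (y s)) t).
    { apply (continuous_comp y); auto.
      apply (lipschitz_continuous _ 1); intros; rewrite Rmult_1_l.
      apply clamp_nonexpansive. }
    apply (continuous_mult (fun s => clamp 0 (2 * c) (y s))); auto.
    apply (continuous_plus (fun s => P s * clamp 0 (2 * c) (y s))).
    + apply (continuous_mult P); auto.
    + apply (continuous_mult Q); auto.
      apply (continuous_pow (fun s => clamp 0 (2 * c) (y s)) (S m)); auto.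
  - intros t x; unfold F; simpl; destruct (Hcl x) as [Hz1 Hz2].
    set (z := clamp 0 (2 * c) x) in *.
    replace (z * (P t * z + Q t * (z * z ^ m))) with ((P t + Q t * z ^ m) * (z * z)) by ring.
    assert (Hzm : Rabs (z ^ m) <= 1).
    { rewrite <- (pow1 m); apply pow_le_bound; rewrite Rabs_pos_eq; lra. }
    rewrite Rabs_mult, (Rabs_pos_eq (z * z)) by nra.
    assert (H : Rabs (P t + Q t * z ^ m) <= 2 * M).
    { eapply Rle_trans; [apply Rabs_triang|]; rewrite Rabs_mult.
      generalize (hPM t) (hQM t) (Rabs_pos (Q t)) (Rabs_pos (z ^ m)); nra. }
    apply Rle_trans with (2 * M * ((2 * c) * (2 * c))); [|lra].
    apply Rmult_le_compat; auto; [apply Rabs_pos | nra | nra].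
  - intros t x y; unfold F; cbv zeta.
    assert (Hxy := clamp_nonexpansive 0 (2 * c) x y).
    destruct (Hcl x) as [Hx1 Hx2]; destruct (Hcl y) as [Hy1 Hy2].
    set (z := clamp 0 (2 * c) x) in *; set (w := clamp 0 (2 * c) y) in *.
    replace (z * (P t * z + Q t * z ^ S m) - w * (P t * w + Q t * w ^ S m)) with
      (P t * (z ^ 2 - w ^ 2) + Q t * (z ^ S (S m) - w ^ S (S m))) by (simpl; ring).
    assert (H1 : Rabs (z ^ 2 - w ^ 2) <= 4 * c * Rabs (x - y)).
    { eapply Rle_trans; [apply (pow_lipschitz z w (2 * c)); rewrite Rabs_pos_eq; lra|].
      simpl; nra. }
    assert (H2 : Rabs (z ^ S (S m) - w ^ S (S m)) <= (INR m + 2) * (2 * c) * Rabs (x - y)).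
    { eapply Rle_trans; [apply (pow_lipschitz z w (2 * c)); rewrite Rabs_pos_eq; lra|].
      rewrite !S_INR.
      apply Rmult_le_compat; auto; try apply Rabs_pos.
      - apply Rmult_le_pos; [lra | apply pow_le; lra].
      - replace (INR m + 1 + 1) with (INR m + 2) by ring.
        apply Rmult_le_compat_l; [lra|]; simpl.
        assert ((2 * c) ^ m <= 1) by (rewrite <- (pow1 m); apply pow_incr; lra).
        nra. }
    eapply Rle_trans; [apply Rabs_triang|]; rewrite !Rabs_mult.
    assert (H3 : Rabs (P t) * Rabs (z ^ 2 - w ^ 2) <= M * (4 * c * Rabs (x - y)))
      by (apply Rmult_le_compat; auto; apply Rabs_pos).
    assert (H4 : Rabs (Q t) * Rabs (z ^ S (S m) - w ^ S (S m))
      <= M * ((INR m + 2) * (2 * c) * Rabs (x - y)))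
      by (apply Rmult_le_compat; auto; apply Rabs_pos).
    assert (H5 : 0 <= (4 + 2 * (INR m + 2)) * (c * Rabs (x - y))).
    { apply Rmult_le_pos; [lra|]; apply Rmult_le_pos; [lra | apply Rabs_pos]. }
    unfold N; nra.
  - assert (Hrange : forall t, c / 2 <= r t <= 3 * c / 2).
    { intros t; specialize (Hrc t).
      assert (8 * M * c * c * (9 - -1) <= c / 2) by nra.
      apply Rabs_le_between in Hrc; lra. }
    exists r; split; [auto|split]; [|auto].
    intros t Ht.
    assert (H := Hr t ltac:(generalize two_PI_lt_9; lra)).
    unfold F in H; rewrite clamp_id in H; [exact H|].
    generalize (Hrange t); lra.
Qed.

(** * Taylor expansion of negative powers of 1 - y *)

(* Taylor coefficients at 0 of (1 - y)^(-m): multiplying a series by 1/(1 - y)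
   replaces its coefficients by their partial sums. *)
Fixpoint inv_pow_coef (m k : nat) : R :=
  match m with
  | O => match k with O => 1 | S _ => 0 end
  | S m => sum_f_R0 (inv_pow_coef m) k
  end.

Lemma inv_pow_coef_0 (m : nat) : inv_pow_coef m 0 = 1.
Proof. induction m; simpl; auto. Qed.

Lemma inv_pow_coef_nonneg (m k : nat) : 0 <= inv_pow_coef m k.
Proof.
  revert k; induction m as [|m IH]; intros k; simpl.
  - destruct k; lra.
  - apply cond_pos_sum; auto.
Qed.

(** Strict positivity allows the Taylor coefficients to be divided out of the moment equations. It
    fails for exponent 0, hence the index [S m]. *)
Lemma inv_pow_coef_pos (m k : nat) : 0 < inv_pow_coef (S m) k.
Proof.
  induction k as [|k IH].
  - rewrite inv_pow_coef_0; lra.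
  - change (inv_pow_coef (S m) (S k)) with (inv_pow_coef (S m) k + inv_pow_coef m (S k)).
    generalize (inv_pow_coef_nonneg m (S k)); lra.
Qed.

(** The truncated form of (1 - y)^(-(m+1)) = (1 - y)^(-m) + y (1 - y)^(-(m+1)). *)
Lemma inv_pow_partial_sum (m N : nat) (y : R) :
  sum_f_R0 (fun k => inv_pow_coef (S m) k * y ^ k) (S N) =
  sum_f_R0 (fun k => inv_pow_coef m k * y ^ k) (S N) +
  y * sum_f_R0 (fun k => inv_pow_coef (S m) k * y ^ k) N.
Proof.
  assert (Hs : forall k, inv_pow_coef (S m) (S k) = inv_pow_coef (S m) k + inv_pow_coef m (S k))
    by reflexivity.
  induction N as [|N IH].
  - rewrite !tech5; cbn [sum_f_R0]; rewrite Hs, !inv_pow_coef_0; simpl; ring.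
  - rewrite !(tech5 _ (S N)), Hs, <- (tech_pow_Rmult y (S N)).
    assert (HB := tech5 (fun k => inv_pow_coef (S m) k * y ^ k) N).
    set (X := sum_f_R0 (fun k => inv_pow_coef (S m) k * y ^ k) (S N)) in *.
    rewrite HB at 2; rewrite IH at 1; ring.
Qed.

Lemma inv_one_minus_bound (y : R) : Rabs y <= / 2 -> 0 < / (1 - y) <= 2.
Proof.
  intros H; apply Rabs_le_between in H; split.
  - apply Rinv_0_lt_compat; lra.
  - rewrite <- (Rinv_inv 2); apply Rinv_le_contravar; lra.
Qed.

(** The function and its Taylor polynomials obey the same recursion, so the remainders do too: that
    of exponent m + 1 and order N + 1 is the one of exponent m and order N + 1 plus y times the one
    of exponent m + 1 and order N. Only order 0 needs a direct estimate. *)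
Lemma inv_pow_taylor (m N : nat) : exists C, forall y, Rabs y <= / 2 ->
  Rabs ((/ (1 - y)) ^ m - sum_f_R0 (fun k => inv_pow_coef m k * y ^ k) N)
    <= C * Rabs y ^ S N.
Proof.
  revert N; induction m as [|m IHm]; intros N.
  - exists 0; intros y _; rewrite Rmult_0_l.
    replace (sum_f_R0 _ N) with 1.
    + simpl; rewrite Rminus_diag, Rabs_R0; lra.
    + induction N as [|N IH]; [simpl; ring | rewrite tech5, <- IH; simpl; ring].
  - assert (E : forall y, Rabs y <= / 2 ->
      (/ (1 - y)) ^ S m = (/ (1 - y)) ^ m + y * (/ (1 - y)) ^ S m).
    { intros y Hy; apply Rabs_le_between in Hy; simpl; field; lra. }
    induction N as [|N [C2 IHN]].
    + destruct (IHm 0%nat) as [C1 H1]; exists (C1 + 2 ^ S m); intros y Hy.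
      assert (H := inv_one_minus_bound y Hy); specialize (H1 y Hy).
      cbn [sum_f_R0] in *; rewrite inv_pow_coef_0 in *.
      rewrite (E y Hy), pow_1 in *; rewrite pow_O in *.
      assert (H2 : Rabs (y * (/ (1 - y)) ^ S m) <= Rabs y * 2 ^ S m).
      { rewrite Rabs_mult; apply Rmult_le_compat_l; [apply Rabs_pos|].
        apply pow_le_bound; rewrite Rabs_pos_eq; lra. }
      match goal with |- Rabs (?p + ?q - ?s) <= _ =>
        replace (p + q - s) with ((p - s) + q) by ring end.
      eapply Rle_trans; [apply Rabs_triang|]; lra.
    + destruct (IHm (S N)) as [C1 H1]; exists (C1 + C2); intros y Hy.
      specialize (H1 y Hy); specialize (IHN y Hy).
      rewrite inv_pow_partial_sum, (E y Hy).
      match goal with |- Rabs (?p + y * ?q - (?s + y * ?t)) <= _ =>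
        replace (p + y * q - (s + y * t)) with ((p - s) + y * (q - t)) by ring end.
      eapply Rle_trans; [apply Rabs_triang|]; rewrite Rabs_mult.
      apply (Rmult_le_compat_l (Rabs y)) in IHN; [|apply Rabs_pos].
      rewrite Rmult_plus_distr_r; apply Rplus_le_compat; auto.
      eapply Rle_trans; [apply IHN|]; simpl; lra.
Qed.

(** * From a small integral to vanishing moments *)

Lemma eq_0_of_linear_bound (d C a0 : R) : 0 < a0 ->
  (forall a, 0 < a <= a0 -> Rabs d <= C * a) -> d = 0.
Proof.
  intros Ha0 H.
  apply Rabs_eq_0, Rle_antisym; [|apply Rabs_pos].
  apply le_epsilon; intros eps Heps; rewrite Rplus_0_l.
  assert (HC : 0 <= C).
  { generalize (H a0 ltac:(lra)) (Rabs_pos d); nra. }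
  assert (Hp : 0 < eps / (C + 1)) by (apply Rdiv_lt_0_compat; lra).
  assert (Hq : C * (eps / (C + 1)) <= eps).
  { replace eps with ((C + 1) * (eps / (C + 1))) at 2 by (field; lra); nra. }
  destruct (Rle_dec (eps / (C + 1)) a0) as [Hle|Hgt].
  - generalize (H _ (conj Hp Hle)); lra.
  - generalize (H a0 ltac:(lra)); nra.
Qed.

(** Letting a tend to 0 kills the constant term; dividing by a then lowers n by one with the same
    constant C. *)
Lemma poly_coef_eq_0 (n : nat) (d : nat -> R) (C a0 : R) : 0 < a0 ->
  (forall a, 0 < a <= a0 -> Rabs (sum_f_R0 (fun k => d k * a ^ k) n) <= C * a ^ S n) ->
  forall k, (k <= n)%nat -> d k = 0.
Proof.
  revert d a0; induction n as [|n IH]; intros d a0 Ha0 H.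
  - intros k Hk; replace k with 0%nat by lia.
    apply (eq_0_of_linear_bound _ C a0 Ha0); intros a Ha.
    generalize (H a Ha); simpl; rewrite !Rmult_1_r; auto.
  - assert (E : forall a, sum_f_R0 (fun k => d k * a ^ k) (S n) =
      d 0%nat + a * sum_f_R0 (fun k => d (S k) * a ^ k) n).
    { intros a; rewrite decomp_sum by lia; cbn [Init.Nat.pred].
      rewrite scal_sum, pow_O, Rmult_1_r; f_equal; apply sum_eq; intros; simpl; ring. }
    assert (H0 : d 0%nat = 0).
    (* Capping a at 1 bounds all its powers by 1, so the terms of positive degree are at most a
       times the sum of the absolute values of their coefficients. *)
    { apply (eq_0_of_linear_bound _ (C + sum_f_R0 (fun k => Rabs (d (S k))) n) (Rmin a0 1)).
      { apply Rmin_pos; lra. }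
      intros a [Ha Ha']; assert (Ha0' := Rle_trans _ _ _ Ha' (Rmin_l _ _)).
      assert (Ha1 := Rle_trans _ _ _ Ha' (Rmin_r _ _)).
      specialize (H a (conj Ha Ha0')); rewrite E in H.
      assert (Hp : 0 <= a ^ S n <= 1).
      { split; [apply pow_le; lra|]. rewrite <- (pow1 (S n)); apply pow_incr; lra. }
      assert (HS : Rabs (sum_f_R0 (fun k => d (S k) * a ^ k) n)
        <= sum_f_R0 (fun k => Rabs (d (S k))) n).
      { eapply Rle_trans; [apply Rsum_abs|]; apply sum_Rle; intros k _.
        rewrite Rabs_mult; apply Rle_trans with (Rabs (d (S k)) * 1); [|lra].
        apply Rmult_le_compat_l; [apply Rabs_pos|].
        rewrite <- (pow1 k); apply pow_le_bound; rewrite Rabs_pos_eq; lra. }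
      set (s := sum_f_R0 (fun k => d (S k) * a ^ k) n) in *.
      set (S' := sum_f_R0 (fun k => Rabs (d (S k))) n) in *.
      replace (d 0%nat) with ((d 0%nat + a * s) - a * s) by ring.
      unfold Rminus; eapply Rle_trans; [apply Rabs_triang|].
      rewrite Rabs_Ropp, Rabs_mult, (Rabs_pos_eq a) by lra.
      assert (HC : 0 <= C * a ^ S (S n)) by (eapply Rle_trans; [apply Rabs_pos | apply H]).
      assert (Hpp : 0 < a ^ S (S n)) by (apply pow_lt; lra).
      assert (HC' : 0 <= C) by nra.
      assert (C * a ^ S (S n) <= C * a).
      { apply Rmult_le_compat_l; auto. change (a * a ^ S n <= a); nra. }
      nra. }
    intros [|k] Hk; [exact H0|].
    apply (IH (fun k => d (S k)) a0 Ha0); [|lia].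
    intros a Ha; specialize (H a Ha); rewrite E, H0, Rplus_0_l, Rabs_mult in H.
    rewrite (Rabs_pos_eq a) in H by lra.
    apply (Rmult_le_reg_l a); [lra|].
    eapply Rle_trans; [apply H|]; simpl; lra.
Qed.

(** Continuity of the partial sums is carried along because the induction needs their
    integrability. *)
Lemma RInt_sum_f_R0 (f : nat -> R -> R) (a b : R) (n : nat) :
  (forall k t, continuous (f k) t) ->
  RInt (fun t => sum_f_R0 (fun k => f k t) n) a b = sum_f_R0 (fun k => RInt (f k) a b) n
  /\ forall t, continuous (fun t => sum_f_R0 (fun k => f k t) n) t.
Proof.
  intros Hf; induction n as [|n [IH IHc]]; simpl; [split; auto|split].
  - rewrite <- IH.
    apply (RInt_plus (fun t => sum_f_R0 (fun k => f k t) n) (f (S n)));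
      apply ex_RInt_cont; auto.
  - intros t; apply (continuous_plus (fun t => sum_f_R0 (fun k => f k t) n)); auto.
Qed.

(** Expanding (1 - a v)^(-(m+1)) to order n turns the integral into a polynomial in a, up to
    O(a^(n+1)), whose coefficients are positive multiples of the moments. By [hC] this polynomial is
    itself O(a^(n+1)), so its coefficients vanish. *)
Lemma moments_vanish (Q v : R -> R) (M C a0 : R) (m n : nat)
  (hQ : forall t, continuous Q t) (hv : forall t, continuous v t)
  (hQM : forall t, Rabs (Q t) <= M) (hvM : forall t, Rabs (v t) <= M)
  (ha0 : 0 < a0) (ha0M : a0 * M <= / 2)
  (hC : forall a, 0 < a <= a0 ->
     Rabs (RInt (fun t => Q t * (/ (1 - a * v t)) ^ S m) 0 (2 * PI)) <= C * a ^ S n) :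
  forall k, (k <= n)%nat -> RInt (fun t => Q t * v t ^ k) 0 (2 * PI) = 0.
Proof.
  assert (HM : 0 <= M) by (generalize (hQM 0) (Rabs_pos (Q 0)); lra).
  assert (HPI := PI_RGT_0).
  destruct (inv_pow_taylor (S m) n) as [D HD].
  set (b := inv_pow_coef (S m)) in *.
  set (mu := fun k => RInt (fun t => Q t * v t ^ k) 0 (2 * PI)).
  intros k Hk.
  apply (Rmult_eq_reg_l (b k)); [rewrite Rmult_0_r | apply Rgt_not_eq, inv_pow_coef_pos].
  change (b k * mu k = 0).
  (* C comes from the hypothesis, the other term from the Taylor remainder, where Q and v are
     bounded by M. The absolute value of D is taken since the sign of D is unknown. *)
  apply (poly_coef_eq_0 n (fun k => b k * mu k) (C + M * (Rabs D * M ^ S n) * (2 * PI)) a0 ha0);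
    [|exact Hk].
  clear k Hk; intros a Ha.
  set (T := fun t => sum_f_R0 (fun k => b k * (a * v t) ^ k) n).
  assert (Hav : forall t, Rabs (a * v t) <= / 2).
  { intros t; rewrite Rabs_mult, (Rabs_pos_eq a) by lra.
    generalize (hvM t) (Rabs_pos (v t)); nra. }
  assert (Hterm : forall k t, continuous (fun t => Q t * (b k * (a * v t) ^ k)) t).
  { intros k t; apply (continuous_mult Q); auto.
    apply (continuous_mult (fun _ => b k)); [apply continuous_const|].
    apply (continuous_pow (fun t => a * v t)).
    apply (continuous_mult (fun _ => a)); [apply continuous_const | auto]. }
  destruct (RInt_sum_f_R0 (fun k t => Q t * (b k * (a * v t) ^ k)) 0 (2 * PI) n Hterm)
    as [HI HcT].
  assert (ET : forall t, sum_f_R0 (fun k => Q t * (b k * (a * v t) ^ k)) n = Q t * T t).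
  { intros t; unfold T; rewrite scal_sum; apply sum_eq; intros; ring. }
  assert (HcT' : forall t, continuous (fun t => Q t * T t) t).
  { intros t; apply (continuous_ext _ _ _ ET), HcT. }
  assert (EI : RInt (fun t => Q t * T t) 0 (2 * PI) =
    sum_f_R0 (fun k => b k * mu k * a ^ k) n).
  { rewrite <- (RInt_ext _ _ _ _ (fun t _ => ET t)), HI.
    apply sum_eq; intros k _; unfold mu.
    assert (Hc : forall t, continuous (fun t => Q t * v t ^ k) t).
    { intros t; apply (continuous_mult Q); auto; apply continuous_pow; auto. }
    assert (HS := RInt_scal (fun t => Q t * v t ^ k) 0 (2 * PI) (b k * a ^ k)
      (ex_RInt_cont _ _ _ Hc)).
    transitivity (scal (b k * a ^ k) (mu k));
      [|change (b k * a ^ k * mu k = b k * mu k * a ^ k); ring].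
    unfold mu; rewrite <- HS.
    apply RInt_ext; intros t _; rewrite Rpow_mult_distr.
    change (Q t * (b k * (a ^ k * v t ^ k)) = b k * a ^ k * (Q t * v t ^ k)); ring. }
  set (G := fun t => (/ (1 - a * v t)) ^ S m).
  assert (HcG : forall t, continuous (fun t => Q t * G t) t).
  { intros t; apply (continuous_mult Q); auto.
    apply (continuous_pow (fun t => / (1 - a * v t)) (S m)).
    apply (continuous_Rinv_comp (fun t => 1 - a * v t)).
    - apply (continuous_minus (fun _ => 1)); [apply continuous_const|].
      apply (continuous_mult (fun _ => a)); [apply continuous_const | auto].
    - specialize (Hav t); apply Rabs_le_between in Hav; lra. }
  assert (HR := RInt_minus (fun t => Q t * G t) (fun t => Q t * T t) 0 (2 * PI)
    (ex_RInt_cont _ _ _ HcG) (ex_RInt_cont _ _ _ HcT')).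
  rewrite EI in HR.
  assert (HB : Rabs (minus (RInt (fun t => Q t * G t) 0 (2 * PI))
    (sum_f_R0 (fun k => b k * mu k * a ^ k) n)) <=
    M * (Rabs D * M ^ S n * a ^ S n) * Rabs (2 * PI - 0)).
  { rewrite <- HR; apply RInt_le_abs.
    - intros t _; apply (continuous_minus (fun t => Q t * G t)); auto.
    - intros t _; change (Rabs (Q t * G t - Q t * T t) <= M * (Rabs D * M ^ S n * a ^ S n)).
      rewrite <- Rmult_minus_distr_l, Rabs_mult.
      apply Rmult_le_compat; auto; try apply Rabs_pos.
      eapply Rle_trans; [apply HD, Hav|].
      rewrite Rabs_mult, (Rabs_pos_eq a), Rpow_mult_distr by lra.
      apply Rle_trans with (Rabs D * (a ^ S n * Rabs (v t) ^ S n)).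
      + apply Rmult_le_compat_r; [|apply Rle_abs].
        apply Rmult_le_pos; apply pow_le; [lra | apply Rabs_pos].
      + rewrite Rmult_assoc; apply Rmult_le_compat_l; [apply Rabs_pos|].
        rewrite Rmult_comm; apply Rmult_le_compat_r; [apply pow_le; lra|].
        apply pow_incr; split; [apply Rabs_pos | auto]. }
  specialize (hC a Ha); fold (G) in hC.
  change (fun t => Q t * (/ (1 - a * v t)) ^ S m) with (fun t => Q t * G t) in hC.
  rewrite Rminus_0_r, (Rabs_pos_eq (2 * PI)) in HB by lra.
  set (s := sum_f_R0 (fun k => b k * mu k * a ^ k) n) in *.
  set (g := RInt (fun t => Q t * G t) 0 (2 * PI)) in *.
  change (minus g s) with (g - s) in HB.
  replace s with (g - (g - s)) by ring.
  eapply Rle_trans; [unfold Rminus at 1; apply Rabs_triang|]; rewrite Rabs_Ropp.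
  lra.
Qed.

(** * The integral identity along a closed solution and its perturbation *)

Lemma is_derive_continuous (f : R -> R) (t l : R) : is_derive f t l -> continuous f t.
Proof. intros H; apply (ex_derive_continuous f); exists l; exact H. Qed.

Lemma deriv_bound_dist (f df : R -> R) (a b t K : R) :
  (forall s, a <= s <= b -> is_derive f s (df s)) ->
  (forall s, a <= s <= b -> Rabs (df s) <= K) ->
  a <= t <= b -> Rabs (f t - f a) <= K * (b - a).
Proof.
  intros Hd HK Ht.
  assert (Hmin : Rmin a t = a) by (apply Rmin_left; lra).
  assert (Hmax : Rmax a t = t) by (apply Rmax_right; lra).
  destruct (MVT_gen f a t df) as (s & Hs & E); rewrite ?Hmin, ?Hmax in *.
  - intros s Hs; apply Hd; lra.
  - intros s Hs; apply continuity_pt_filterlim, (is_derive_continuous f s (df s)), Hd; lra.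
  - rewrite E, Rabs_mult, (Rabs_pos_eq (t - a)) by lra.
    apply Rmult_le_compat; try lra; [apply Rabs_pos | apply HK; lra].
Qed.

(* In the variable z = 1/r + v the equation reads z' = - Q r^(m+1), so z^(m+2)
   is a periodic primitive of a multiple of Q (1 - v/z)^(-(m+1)). *)
Lemma center_integral_eq_0 (P Q v r : R -> R) (m : nat)
  (hP : forall t, continuous P t) (hQ : forall t, continuous Q t)
  (hv : forall t, is_derive v t (P t)) (hv2 : v (2 * PI) = v 0)
  (hr : solution_on_period (fun t x => x * (P t * x + Q t * x ^ S (S m))) r)
  (hr0 : forall t, 0 <= t <= 2 * PI -> 0 < r t)
  (hz0 : forall t, 0 <= t <= 2 * PI -> 0 < / r t + v t)
  (hr2 : r (2 * PI) = r 0) :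
  RInt (fun t => Q t * (/ (1 - / (/ r t + v t) * v t)) ^ S m) 0 (2 * PI) = 0 /\
  (forall t, 0 <= t <= 2 * PI ->
     is_derive (fun t => / r t + v t) t (- Q t * r t ^ S m)).
Proof.
  assert (HPI := PI_RGT_0).
  assert (Hmin : Rmin 0 (2 * PI) = 0) by (apply Rmin_left; lra).
  assert (Hmax : Rmax 0 (2 * PI) = 2 * PI) by (apply Rmax_right; lra).
  set (z := fun t => / r t + v t).
  assert (Hz : forall t, 0 <= t <= 2 * PI -> is_derive z t (- Q t * r t ^ S m)).
  { intros t Ht; specialize (hr t Ht); specialize (hr0 t Ht).
    replace (- Q t * r t ^ S m) with
      (- (r t * (P t * r t + Q t * r t ^ S (S m))) / (r t) ^ 2 + P t)
      by (rewrite <- !tech_pow_Rmult; field; lra).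
    apply (is_derive_plus (fun t => / r t)); [|apply hv].
    apply is_derive_inv; [exact hr | lra]. }
  split; [|exact Hz].
  set (w := fun t => - INR (S (S m)) * (Q t * (/ (1 - / z t * v t)) ^ S m)).
  assert (Hw : forall t, 0 <= t <= 2 * PI -> is_derive (fun t => z t ^ S (S m)) t (w t)).
  { intros t Ht; specialize (hr0 t Ht); specialize (hz0 t Ht).
    change (0 < z t) in hz0.
    (* Since z - v = 1/r, the power r^(m+1) in z', multiplied by z^(m+1), is a power of this
       factor. *)
    assert (E : / (1 - / z t * v t) = z t * r t).
    { assert (Hv : v t = z t - / r t) by (unfold z; ring).
      rewrite Hv; field; repeat split; lra. }
    unfold w; rewrite E, Rpow_mult_distr.
    replace (- INR (S (S m)) * (Q t * (z t ^ S m * r t ^ S m))) with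
      (INR (S (S m)) * (- Q t * r t ^ S m) * z t ^ Init.Nat.pred (S (S m)))
      by (cbn [Init.Nat.pred]; ring).
    apply (is_derive_pow z (S (S m))), Hz, Ht. }
  assert (Hc : forall t, 0 <= t <= 2 * PI ->
    continuous (fun t => Q t * (/ (1 - / z t * v t)) ^ S m) t).
  { intros t Ht.
    assert (Hzc : continuous z t) by (eapply is_derive_continuous; apply Hz, Ht).
    assert (Hvc : continuous v t) by (eapply is_derive_continuous; apply hv).
    specialize (hr0 t Ht); specialize (hz0 t Ht); change (0 < z t) in hz0.
    apply (continuous_mult Q); auto.
    apply (continuous_pow (fun t => / (1 - / z t * v t)) (S m)).
    apply (continuous_Rinv_comp (fun t => 1 - / z t * v t)).
    - apply (continuous_minus (fun _ => 1)); [apply continuous_const|].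
      apply (continuous_mult (fun t => / z t)); auto.
      apply (continuous_Rinv_comp z); [exact Hzc | lra].
    - assert (Hv : v t = z t - / r t) by (unfold z; ring).
      rewrite Hv; replace (1 - / z t * (z t - / r t)) with (/ z t * / r t) by (field; lra).
      apply Rmult_integral_contrapositive; split; apply Rinv_neq_0_compat; lra. }
  assert (HI := is_RInt_derive (fun t => z t ^ S (S m)) w 0 (2 * PI)).
  rewrite Hmin, Hmax in HI.
  specialize (HI Hw).
  assert (HI2 : is_RInt w 0 (2 * PI) 0).
  { replace 0 with (minus (z (2 * PI) ^ S (S m)) (z 0 ^ S (S m))) at 2.
    - apply HI; intros t Ht; unfold w.
      apply (continuous_mult (fun _ => - INR (S (S m)))); [apply continuous_const|].
      apply Hc, Ht.
    - unfold z; rewrite hr2, hv2; apply Rminus_diag. }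
  assert (HI3 : RInt w 0 (2 * PI) = 0) by exact (is_RInt_unique w _ _ 0 HI2).
  assert (HS := RInt_scal (fun t => Q t * (/ (1 - / z t * v t)) ^ S m) 0 (2 * PI)
    (- INR (S (S m)))).
  assert (Hne : - INR (S (S m)) <> 0).
  { apply Ropp_neq_0_compat, not_0_INR; lia. }
  apply (Rmult_eq_reg_l (- INR (S (S m)))); [|exact Hne].
  rewrite Rmult_0_r; transitivity (RInt w 0 (2 * PI)); [|exact HI3].
  symmetry; apply HS.
  apply (@ex_RInt_continuous R_CompleteNormedModule); rewrite Hmin, Hmax; exact Hc.
Qed.

(** In the exact identity 1/z(t) is replaced by its initial value a. As r <= 2a, the derivative of z
    is O(a^(m+1)), and so a - 1/z = (a/z) (z - 1/a) is O(a^(m+3)); the integrand changes by no more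
    than that order. *)
Lemma center_integral_bound (P Q v : R -> R) (M : R) (m : nat)
  (hP : forall t, continuous P t) (hQ : forall t, continuous Q t)
  (hPM : forall t, Rabs (P t) <= M) (hQM : forall t, Rabs (Q t) <= M)
  (hv : forall t, is_derive v t (P t)) (hv2 : v (2 * PI) = v 0)
  (hvM : forall t, Rabs (v t) <= M)
  (hcenter : is_center (fun t x => x * (P t * x + Q t * x ^ S (S m)))) :
  exists a0 C, 0 < a0 /\ a0 * M <= / 2 /\ forall a, 0 < a <= a0 ->
    Rabs (RInt (fun t => Q t * (/ (1 - a * v t)) ^ S m) 0 (2 * PI)) <= C * a ^ S (S (S m)).
Proof.
  assert (HPI := PI_RGT_0).
  assert (HM : 0 <= M) by (generalize (hPM 0) (Rabs_pos (P 0)); lra).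
  assert (Hvc : forall t, continuous v t)
    by (intros t; eapply is_derive_continuous; apply hv).
  destruct hcenter as (delta & Hdelta & Hcen).
  destruct (small_solution P Q M (S m) hP hQ hPM hQM) as (c0 & Hc0 & Hsol).
  set (a1 := / (8 * (M + 1))).
  assert (Ha1 : a1 * (8 * (M + 1)) = 1) by (unfold a1; field; lra).
  assert (Ha1p : 0 < a1) by (apply Rinv_0_lt_compat; lra).
  (* The first bound gives a M <= 1/8, so that v is small against 1/a; the second puts the initial
     value c <= 8a/7 below c0; the third keeps r <= 2a below delta, where the center hypothesis
     applies. *)
  set (a0 := Rmin a1 (Rmin (c0 / 2) (delta / 4))).
  assert (Ha0p : 0 < a0) by (unfold a0; repeat apply Rmin_pos; lra).
  assert (Ha01 : a0 <= a1) by apply Rmin_l.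
  assert (Ha0c : a0 <= c0 / 2) by (eapply Rle_trans; [apply Rmin_r | apply Rmin_l]).
  assert (Ha0d : a0 <= delta / 4) by (eapply Rle_trans; [apply Rmin_r | apply Rmin_r]).
  clearbody a0.
  assert (Ha0M : a0 * M <= / 8) by nra.
  (* The factor (m + 1) 2^m is the Lipschitz constant of the power m + 1 on bases at most 2; 4M
     bounds the product of the two bases and v; the last factor comes from [Hxa]. *)
  set (K := INR (S m) * 2 ^ m * (4 * M) * (4 * (M * 2 ^ S m * (2 * PI)))).
  exists a0, (M * K * (2 * PI)); split; [exact Ha0p | split; [lra|]].
  intros a Ha.
  assert (HaM : a * M <= / 8) by nra.
  assert (Hav : forall t, Rabs (a * v t) <= / 8).
  { intros t; rewrite Rabs_mult, (Rabs_pos_eq a) by lra.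
    generalize (hvM t) (Rabs_pos (v t)); nra. }
  (* This initial value of r makes z(0) = 1/c + v(0) equal to 1/a. *)
  set (c := a / (1 - a * v 0)).
  assert (Hq : 7/8 <= 1 - a * v 0 <= 9/8)
    by (generalize (Hav 0); intros H; apply Rabs_le_between in H; lra).
  assert (Hcq : c * (1 - a * v 0) = a) by (unfold c; field; lra).
  assert (Hc : 0 < c <= 8/7 * a).
  { split; [apply Rdiv_lt_0_compat; lra | nra]. }
  destruct (Hsol c ltac:(lra)) as (r & Hr0 & Hr & Hrc).
  assert (Hrp : forall t, 0 < r t) by (intros t; generalize (Hrc t); lra).
  assert (Hr2a : forall t, r t <= 2 * a) by (intros t; generalize (Hrc t); lra).
  set (z := fun t => / r t + v t).
  assert (Hz : forall t, / (4 * a) <= z t).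
  { intros t; unfold z.
    assert (H1 : / (2 * a) <= / r t) by (apply Rinv_le_contravar; auto).
    assert (H2 := Hav t); apply Rabs_le_between in H2.
    assert (H3 : a * / (2 * a) = / 2) by (field; lra).
    assert (H4 : a * / (4 * a) = / 4) by (field; lra).
    apply (Rmult_le_reg_l a); [lra|].
    apply (Rmult_le_compat_l a) in H1; lra. }
  assert (Ha4 : 0 < / (4 * a)) by (apply Rinv_0_lt_compat; lra).
  assert (Hzp : forall t, 0 < z t) by (intros t; generalize (Hz t); lra).
  assert (Hclose : r (2 * PI) = r 0).
  { apply Hcen; [exact Hr|]; intros t _; rewrite Rabs_pos_eq.
    - generalize (Hr2a t); lra.
    - generalize (Hrp t); lra. }
  destruct (center_integral_eq_0 P Q v r m hP hQ hv hv2 Hr (fun t _ => Hrp t)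
    (fun t _ => Hzp t) Hclose) as [HI Hdz].
  fold z in Hdz.
  change (fun t => Q t * (/ (1 - / (/ r t + v t) * v t)) ^ S m) with
    (fun t => Q t * (/ (1 - / z t * v t)) ^ S m) in HI.
  assert (Hz0 : z 0 = / a).
  { unfold z; rewrite Hr0; unfold c; field; lra. }
  assert (Hx : forall t, 0 < / z t <= 4 * a).
  { intros t; split; [apply Rinv_0_lt_compat; auto|].
    rewrite <- (Rinv_inv (4 * a)); apply Rinv_le_contravar; auto. }
  assert (Hxa : forall t, 0 <= t <= 2 * PI ->
    Rabs (a - / z t) <= 4 * (M * 2 ^ S m * (2 * PI)) * a ^ S (S (S m))).
  { intros t Ht.
    assert (H : Rabs (z t - z 0) <= M * (2 * a) ^ S m * (2 * PI - 0)).
    { apply (deriv_bound_dist z (fun t => - Q t * r t ^ S m)); auto.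
      intros s _; rewrite Rabs_mult, Rabs_Ropp.
      apply Rmult_le_compat; auto; try apply Rabs_pos.
      apply pow_le_bound; rewrite Rabs_pos_eq; [auto | generalize (Hrp s); lra]. }
    replace (a - / z t) with (a * / z t * (z t - z 0))
      by (rewrite Hz0; field; split; [generalize (Hzp t)|]; lra).
    rewrite Rabs_mult, (Rabs_pos_eq (a * / z t))
      by (apply Rmult_le_pos; [lra | generalize (Hx t); lra]).
    apply Rle_trans with (a * (4 * a) * (M * (2 * a) ^ S m * (2 * PI - 0))).
    - apply Rmult_le_compat; auto; try apply Rabs_pos.
      + apply Rmult_le_pos; [lra | generalize (Hx t); lra].
      + apply Rmult_le_compat_l; [lra | apply Hx].
    - rewrite Rpow_mult_distr, <- !(tech_pow_Rmult a); right; ring. }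
  set (g := fun x t => / (1 - x * v t)).
  assert (Hg : forall x t, 0 < x <= 4 * a -> 0 < g x t <= 2).
  { intros x t Hxx; apply inv_one_minus_bound; rewrite Rabs_mult, (Rabs_pos_eq x) by lra.
    generalize (hvM t) (Rabs_pos (v t)); nra. }
  assert (Hgx : forall x t, 0 < x <= 4 * a -> 1 - x * v t <> 0).
  { intros x t Hxx E; generalize (Hg x t Hxx); unfold g; rewrite E, Rinv_0; lra. }
  assert (Hgc : forall x t, 0 <= t <= 2 * PI -> continuous x t ->
    0 < x t <= 4 * a -> continuous (fun t => Q t * g (x t) t ^ S m) t).
  { intros x t Ht Hxc Hxx; apply (continuous_mult Q); auto.
    apply (continuous_pow (fun t => g (x t) t) (S m)).
    apply (continuous_Rinv_comp (fun t => 1 - x t * v t)); [|apply Hgx; auto].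
    apply (continuous_minus (fun _ => 1)); [apply continuous_const|].
    apply (continuous_mult x); auto. }
  assert (Hca : forall t, 0 <= t <= 2 * PI -> continuous (fun t => Q t * g a t ^ S m) t).
  { intros t Ht; apply (Hgc (fun _ => a)); auto; [apply continuous_const | lra]. }
  assert (Hcz : forall t, 0 <= t <= 2 * PI -> continuous (fun t => Q t * g (/ z t) t ^ S m) t).
  { intros t Ht; apply (Hgc (fun t => / z t)); auto.
    apply (continuous_Rinv_comp z); [|apply Rgt_not_eq, Hzp].
    eapply is_derive_continuous; apply Hdz, Ht. }
  assert (Hmin : Rmin 0 (2 * PI) = 0) by (apply Rmin_left; lra).
  assert (Hmax : Rmax 0 (2 * PI) = 2 * PI) by (apply Rmax_right; lra).
  assert (HR := RInt_minus (fun t => Q t * g a t ^ S m) (fun t => Q t * g (/ z t) t ^ S m)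
    0 (2 * PI)).
  (* The sixth occurrence lies in the subtracted integral on the right, the one that [HI] turns into
     0. *)
  unfold g at 6 in HR; rewrite HI in HR.
  assert (HG : forall x : R, minus x 0 = x) by exact Rminus_0_r.
  rewrite HG in HR.
  change (fun t => Q t * (/ (1 - a * v t)) ^ S m) with (fun t => Q t * g a t ^ S m).
  rewrite <- HR;
    try (apply (@ex_RInt_continuous R_CompleteNormedModule); rewrite Hmin, Hmax; auto).
  replace (M * K * (2 * PI) * a ^ S (S (S m))) with
    (M * (K * a ^ S (S (S m))) * Rabs (2 * PI - 0))
    by (rewrite Rminus_0_r, Rabs_pos_eq by lra; ring).
  apply RInt_le_abs; rewrite Hmin, Hmax; intros t Ht.
  - apply (continuous_minus (fun t => Q t * g a t ^ S m)); auto.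
  - change (Rabs (Q t * g a t ^ S m - Q t * g (/ z t) t ^ S m) <= M * (K * a ^ S (S (S m)))).
    rewrite <- Rmult_minus_distr_l, Rabs_mult.
    apply Rmult_le_compat; auto; try apply Rabs_pos.
    assert (H1 := Hg a t ltac:(lra)); assert (H2 := Hg (/ z t) t (Hx t)).
    eapply Rle_trans; [apply (pow_lipschitz _ _ 2); rewrite Rabs_pos_eq; lra|].
    replace (K * a ^ S (S (S m))) with (INR (S m) * 2 ^ m *
      (4 * M * (4 * (M * 2 ^ S m * (2 * PI)) * a ^ S (S (S m))))) by (unfold K; ring).
    apply Rmult_le_compat_l.
    { apply Rmult_le_pos; [apply pos_INR | apply pow_le; lra]. }
    (* Resolvent identity: 1/(1 - a v) - 1/(1 - x v) = v (a - x) / ((1 - a v) (1 - x v)). *)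
    replace (g a t - g (/ z t) t) with (g a t * g (/ z t) t * v t * (a - / z t)).
    2:{ assert (E1 := Hgx a t ltac:(lra)); assert (E2 := Hgx (/ z t) t (Hx t)).
        unfold g; set (x := / z t) in *; field; auto. }
    rewrite Rabs_mult.
    apply Rmult_le_compat; try apply Rabs_pos; [|apply Hxa, Ht].
    rewrite !Rabs_mult, !(Rabs_pos_eq (g _ _)) by lra.
    generalize (hvM t) (Rabs_pos (v t)); intros.
    replace (4 * M) with (2 * 2 * M) by ring.
    apply Rmult_le_compat; auto; [|apply Rmult_le_compat; lra].
    apply Rmult_le_pos; lra.
Qed.

(** * Polynomial functions, and integrals that vanish *)

(** Polynomial functions of degree below N in Horner form; peeling off the constant term drives the
    inductions. *)
Fixpoint poly_deg_lt (N : nat) (f : R -> R) : Prop :=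
  match N with
  | O => forall x, f x = 0
  | S N => exists c g, poly_deg_lt N g /\ forall x, f x = c + x * g x
  end.

Lemma poly_deg_lt_ext (N : nat) (f g : R -> R) :
  (forall x, f x = g x) -> poly_deg_lt N f -> poly_deg_lt N g.
Proof.
  destruct N as [|N]; simpl; intros E H.
  - intros x; rewrite <- E; auto.
  - destruct H as (c & h & Hh & H); exists c, h; split; auto.
    intros x; rewrite <- E; auto.
Qed.

Lemma poly_deg_lt_add (N : nat) (f g : R -> R) :
  poly_deg_lt N f -> poly_deg_lt N g -> poly_deg_lt N (fun x => f x + g x).
Proof.
  revert f g; induction N as [|N IH]; simpl; intros f g Hf Hg.
  - intros x; rewrite Hf, Hg; ring.
  - destruct Hf as (c & f1 & Hf1 & Ef); destruct Hg as (d & g1 & Hg1 & Eg).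
    exists (c + d), (fun x => f1 x + g1 x); split; auto.
    intros x; rewrite Ef, Eg; ring.
Qed.

Lemma poly_deg_lt_scal (N : nat) (k : R) (f : R -> R) :
  poly_deg_lt N f -> poly_deg_lt N (fun x => k * f x).
Proof.
  revert f; induction N as [|N IH]; simpl; intros f Hf.
  - intros x; rewrite Hf; ring.
  - destruct Hf as (c & f1 & Hf1 & Ef).
    exists (k * c), (fun x => k * f1 x); split; auto.
    intros x; rewrite Ef; ring.
Qed.

Lemma poly_deg_lt_mulX (N : nat) (f : R -> R) :
  poly_deg_lt N f -> poly_deg_lt (S N) (fun x => x * f x).
Proof. intros Hf; exists 0, f; split; auto; intros x; ring. Qed.

Lemma poly_deg_lt_S (N : nat) (f : R -> R) : poly_deg_lt N f -> poly_deg_lt (S N) f.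
Proof.
  revert f; induction N as [|N IH]; intros f Hf.
  - exists 0, f; split; auto; intros x; rewrite (Hf x); ring.
  - destruct Hf as (c & f1 & Hf1 & Ef); exists c, f1; split; auto.
Qed.

Lemma poly_deg_lt_continuous (N : nat) (f : R -> R) :
  poly_deg_lt N f -> forall x, continuous f x.
Proof.
  revert f; induction N as [|N IH]; simpl; intros f Hf x.
  - apply (continuous_ext (fun _ => 0)); [auto | apply continuous_const].
  - destruct Hf as (c & g & Hg & E).
    apply (continuous_ext (fun x => c + x * g x)); [auto|].
    apply (continuous_plus (fun _ => c)); [apply continuous_const|].
    apply (continuous_mult (fun x : R => x) g); [apply continuous_id | auto].
Qed.

Lemma RInt_extR (f g : R -> R) (a b : R) :
  (forall t, f t = g t) -> RInt f a b = RInt g a b.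
Proof. intros E; apply RInt_ext; intros t _; apply E. Qed.

Lemma RInt_lin_comb (f g : R -> R) (a b c : R) :
  (forall t, continuous f t) -> (forall t, continuous g t) ->
  RInt (fun t => c * f t + g t) a b = c * RInt f a b + RInt g a b.
Proof.
  intros Hf Hg.
  assert (Hcf : forall t, continuous (fun t => c * f t) t).
  { intros t; apply (continuous_mult (fun _ => c)); [apply continuous_const | auto]. }
  apply (is_RInt_unique (fun t => c * f t + g t)).
  apply (is_RInt_plus (fun t => c * f t) g).
  - apply (is_RInt_scal f), (@RInt_correct R_CompleteNormedModule), ex_RInt_cont, Hf.
  - apply (@RInt_correct R_CompleteNormedModule), ex_RInt_cont, Hg.
Qed.

(** Each Horner step trades one degree of f for one power of v, so k + j is invariant and no moment
    beyond n is used. *)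
Lemma RInt_poly_eq_0 (Q v f : R -> R) (a b : R) (n j k : nat)
  (hQ : forall t, continuous Q t) (hv : forall t, continuous v t)
  (hmom : forall k, (k <= n)%nat -> RInt (fun t => Q t * v t ^ k) a b = 0) :
  poly_deg_lt j f -> (k + j <= S n)%nat ->
  RInt (fun t => Q t * v t ^ k * f (v t)) a b = 0.
Proof.
  revert k f; induction j as [|j IH]; intros k f Hf Hk.
  - rewrite (RInt_extR _ (fun _ => 0)).
    + rewrite RInt_const; apply Rmult_0_r.
    + intros t; rewrite (Hf (v t)); ring.
  - destruct Hf as (c & g & Hg & E).
    rewrite (RInt_extR _ (fun t => c * (Q t * v t ^ k) + Q t * v t ^ S k * g (v t)))
      by (intros t; rewrite E; simpl; ring).
    assert (Hc : forall i t, continuous (fun t => Q t * v t ^ i) t).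
    { intros i t; apply (continuous_mult Q); auto; apply continuous_pow; auto. }
    rewrite RInt_lin_comb; auto.
    + rewrite hmom by lia; rewrite IH by (auto; lia).
      change (c * 0 + 0 = 0); ring.
    + intros t; apply (continuous_mult (fun t => Q t * v t ^ S k)); auto.
      apply (continuous_comp v); auto; apply (poly_deg_lt_continuous j); auto.
Qed.

(** A positive value at t would persist on an interval to the right of t and make the integral
    positive. Excluding b leaves room for that interval, and a half-open period still represents
    every point of a periodic function. *)
Lemma RInt_nonneg_eq_0 (f : R -> R) (a b : R) :
  (forall t, continuous f t) -> (forall t, 0 <= f t) -> a < b ->
  RInt f a b = 0 -> forall t, a <= t < b -> f t = 0.
Proof.
  intros Hc Hp Hab HI t Ht.
  apply Rle_antisym; [|apply Hp]; apply Rnot_lt_le; intros Hlt.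
  assert (Hl := proj1 (continuity_pt_locally f t)
    (proj2 (continuity_pt_filterlim f t) (Hc t)) (mkposreal _ Hlt)).
  destruct Hl as [d Hd]; simpl in Hd.
  assert (Hd0 := cond_pos d).
  set (e := Rmin d (b - t)).
  assert (He : 0 < e) by (unfold e; repeat apply Rmin_pos; lra).
  assert (He1 : e <= d) by apply Rmin_l.
  assert (He2 : e <= b - t) by apply Rmin_r.
  clearbody e.
  assert (H1 : 0 <= RInt f a t)
    by (apply RInt_ge_0; auto; [lra | apply ex_RInt_cont; auto]).
  assert (H3 : 0 <= RInt f (t + e) b)
    by (apply RInt_ge_0; auto; [lra | apply ex_RInt_cont; auto]).
  assert (H2 : 0 < RInt f t (t + e)).
  { apply RInt_gt_0; auto; [lra|]; intros s Hs.
    assert (Hb : Rabs (s - t) < d) by (apply Rabs_lt_between; lra).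
    specialize (Hd s Hb); apply Rabs_lt_between in Hd; lra. }
  assert (E1 := RInt_Chasles f a t (t + e)
    (ex_RInt_cont _ _ _ Hc) (ex_RInt_cont _ _ _ Hc)).
  assert (E2 := RInt_Chasles f a (t + e) b
    (ex_RInt_cont _ _ _ Hc) (ex_RInt_cont _ _ _ Hc)).
  unfold plus in E1, E2; simpl in E1, E2; lra.
Qed.

Lemma periodic_representative (f : R -> R) (T : R) : 0 < T ->
  (forall t, f (t + T) = f t) -> forall t, exists s, 0 <= s < T /\ f s = f t.
Proof.
  intros HT Hf t.
  assert (Hn : forall (n : nat) s, f (s + INR n * T) = f s).
  { induction n as [|n IH]; intros s; [simpl; f_equal; ring|].
    rewrite S_INR, <- (IH s), <- (Hf (s + INR n * T)); f_equal; ring. }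
  exists (t - IZR (Int_part (t / T)) * T).
  destruct (base_Int_part (t / T)) as [H1 H2].
  set (k := Int_part (t / T)) in *.
  assert (Ht : t / T * T = t) by (field; lra).
  split; [nra|].
  destruct (Z.le_gt_cases 0 k) as [Hk|Hk].
  - rewrite <- (Hn (Z.to_nat k)); f_equal.
    rewrite INR_IZR_INZ, Z2Nat.id by lia; ring.
  - rewrite <- (Hn (Z.to_nat (- k)) t); f_equal.
    rewrite INR_IZR_INZ, Z2Nat.id, opp_IZR by lia; ring.
Qed.

(** * Trigonometric polynomials in terms of v and w = v' *)

Lemma homogeneous_trig_continuous (n : nat) (p : nat -> nat -> R) (t : R) :
  continuous (homogeneous_trig n p) t.
Proof.
  (* Only the continuity half is taken; the integration limits 0 and 0 are placeholders. *)
  revert t; apply (fun H => proj2 (RInt_sum_f_R0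
    (fun i t => p i (n - i)%nat * cos t ^ i * sin t ^ (n - i)) 0 0 n H)).
  intros k t.
  apply (continuous_mult (fun t => p k (n - k)%nat * cos t ^ k)).
  - apply (continuous_mult (fun _ => p k (n - k)%nat)); [apply continuous_const|].
    apply (continuous_pow cos), continuous_cos.
  - apply (continuous_pow sin), continuous_sin.
Qed.

Lemma homogeneous_trig_bounded (n : nat) (p : nat -> nat -> R) :
  exists M, forall t, Rabs (homogeneous_trig n p t) <= M.
Proof.
  exists (sum_f_R0 (fun i => Rabs (p i (n - i)%nat)) n); intros t.
  unfold homogeneous_trig; eapply Rle_trans; [apply Rsum_abs|].
  apply sum_Rle; intros k _; rewrite !Rabs_mult.
  assert (Hc : Rabs (cos t ^ k) <= 1)
    by (rewrite <- (pow1 k); apply pow_le_bound, Rabs_le, COS_bound).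
  assert (Hs : Rabs (sin t ^ (n - k)) <= 1)
    by (rewrite <- (pow1 (n - k)); apply pow_le_bound, Rabs_le, SIN_bound).
  set (P := Rabs (p k (n - k)%nat)).
  assert (HP : 0 <= P) by apply Rabs_pos.
  generalize (Rabs_pos (cos t ^ k)) (Rabs_pos (sin t ^ (n - k))); intros.
  replace P with (P * 1 * 1) at 2 by ring.
  apply Rmult_le_compat; auto; [nra|]. apply Rmult_le_compat; lra.
Qed.

Lemma linear_trig_bound (A B t : R) : Rabs (linear_trig A B t) <= Rabs A + Rabs B.
Proof.
  unfold linear_trig; eapply Rle_trans; [apply Rabs_triang|]; rewrite !Rabs_mult.
  assert (Hc : Rabs (cos t) <= 1) by apply Rabs_le, COS_bound.
  assert (Hs : Rabs (sin t) <= 1) by apply Rabs_le, SIN_bound.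
  generalize (Rabs_pos A) (Rabs_pos B); nra.
Qed.

(** Among the primitives of w this is the one with v^2 + w^2 = A^2 + B^2. *)
Lemma linear_trig_primitive (A B t : R) :
  is_derive (linear_trig (- B) A) t (linear_trig A B t).
Proof. unfold linear_trig; auto_derive; auto; ring. Qed.

(** Normal form H(v) + w K(v) of a polynomial of degree at most N in v and w, modulo the relation
    that v^2 + w^2 is constant. *)
Definition split_deg (A B : R) (N : nat) (f : R -> R) : Prop :=
  exists H K, poly_deg_lt (S N) H /\ poly_deg_lt N K /\
    forall t, f t = H (linear_trig (- B) A t) + linear_trig A B t * K (linear_trig (- B) A t).

Lemma split_deg_ext (A B : R) (N : nat) (f g : R -> R) :
  (forall t, f t = g t) -> split_deg A B N f -> split_deg A B N g.
Proof.
  intros E (H & K & HH & HK & Ef); exists H, K; repeat split; auto.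
  intros t; rewrite <- E; auto.
Qed.

Lemma split_deg_add (A B : R) (N : nat) (f g : R -> R) :
  split_deg A B N f -> split_deg A B N g -> split_deg A B N (fun t => f t + g t).
Proof.
  intros (H & K & HH & HK & Ef) (H' & K' & HH' & HK' & Eg).
  exists (fun x => H x + H' x), (fun x => K x + K' x); repeat split.
  - apply poly_deg_lt_add; auto.
  - apply poly_deg_lt_add; auto.
  - intros t; rewrite Ef, Eg; ring.
Qed.

Lemma split_deg_scal (A B : R) (N : nat) (k : R) (f : R -> R) :
  split_deg A B N f -> split_deg A B N (fun t => k * f t).
Proof.
  intros (H & K & HH & HK & Ef).
  exists (fun x => k * H x), (fun x => k * K x); repeat split.
  - apply poly_deg_lt_scal; auto.
  - apply poly_deg_lt_scal; auto.
  - intros t; rewrite Ef; ring.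
Qed.

(* Powers of [linear_trig A B] above the first are eliminated with
   w^2 = A^2 + B^2 - v^2. *)
Lemma split_deg_mul_linear (A B : R) (N : nat) (al be : R) (f : R -> R) :
  split_deg A B N f ->
  split_deg A B (S N)
    (fun t => (al * linear_trig A B t + be * linear_trig (- B) A t) * f t).
Proof.
  intros (H & K & HH & HK & Ef).
  exists (fun x => be * (x * H x) + (al * (A ^ 2 + B ^ 2) * K x + - al * (x * (x * K x)))),
    (fun x => al * H x + be * (x * K x)); repeat split.
  - apply poly_deg_lt_add; [|apply poly_deg_lt_add]; apply poly_deg_lt_scal.
    + apply poly_deg_lt_mulX; auto.
    + do 2 apply poly_deg_lt_S; auto.
    + do 2 apply (poly_deg_lt_mulX _ _); auto.
  - apply poly_deg_lt_add; apply poly_deg_lt_scal; auto.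
    apply poly_deg_lt_mulX; auto.
  - intros t; rewrite Ef.
    set (v := linear_trig (- B) A t); set (w := linear_trig A B t).
    assert (Hw : A ^ 2 + B ^ 2 = w * w + v * v).
    { unfold w, v, linear_trig; generalize (sin2_cos2 t); unfold Rsqr; intros E.
      transitivity ((A ^ 2 + B ^ 2) * (sin t * sin t + cos t * cos t)); [rewrite E|]; ring. }
    rewrite Hw; ring.
Qed.

(** As A^2 + B^2 is nonzero, the rotation can be inverted: cos = (A w - B v) / (A^2 + B^2) and sin =
    (B w + A v) / (A^2 + B^2). Each factor then raises the degree by one. *)
Lemma split_deg_monomial (A B : R) (i j : nat) : A ^ 2 + B ^ 2 <> 0 ->
  split_deg A B (i + j) (fun t => cos t ^ i * sin t ^ j).
Proof.
  intros HAB; induction i as [|i IH].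
  - induction j as [|j IH].
    + exists (fun _ => 1), (fun _ => 0); repeat split.
      * exists 1, (fun _ => 0); split; [intros x; reflexivity | intros x; ring].
      * intros t; simpl; ring.
    + eapply split_deg_ext;
        [|exact (split_deg_mul_linear A B j (B / (A ^ 2 + B ^ 2)) (A / (A ^ 2 + B ^ 2)) _ IH)].
      intros t; unfold linear_trig; rewrite <- (tech_pow_Rmult (sin t) j); field; exact HAB.
  - eapply split_deg_ext;
      [|exact (split_deg_mul_linear A B (i + j) (A / (A ^ 2 + B ^ 2))
        (- B / (A ^ 2 + B ^ 2)) _ IH)].
    intros t; unfold linear_trig; rewrite <- (tech_pow_Rmult (cos t) i); field; exact HAB.
Qed.

Lemma split_deg_homogeneous (A B : R) (n : nat) (p : nat -> nat -> R) :
  A ^ 2 + B ^ 2 <> 0 -> split_deg A B n (homogeneous_trig n p).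
Proof.
  intros HAB.
  (* The summands depend on n, so n stays fixed and the induction runs over the upper summation
     index. *)
  assert (H : forall N, (N <= n)%nat -> split_deg A B n
    (fun t => sum_f_R0 (fun i => p i (n - i)%nat * cos t ^ i * sin t ^ (n - i)) N)).
  2: { apply H; lia. }
  assert (H1 : forall i, (i <= n)%nat ->
    split_deg A B n (fun t => p i (n - i)%nat * cos t ^ i * sin t ^ (n - i))).
  { intros i Hi.
    apply (split_deg_ext _ _ _ (fun t => p i (n - i)%nat * (cos t ^ i * sin t ^ (n - i))));
      [intros; ring|].
    apply split_deg_scal; replace n with (i + (n - i))%nat at 1 by lia.
    apply split_deg_monomial, HAB. }
  induction N as [|N IH]; intros HN; simpl; [apply (H1 0%nat); lia|].
  apply split_deg_add; [apply IH; lia | apply H1, HN].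
Qed.

(** * From vanishing moments to the composition condition *)

Theorem mainTheorem4 (n : nat) (hn : (2 <= n)%nat)
  (A B : R) (hAB : A ^ 2 + B ^ 2 <> 0) (p : nat -> nat -> R)
  (hcenter : is_center (fun theta r =>
     r * (linear_trig A B theta * r + homogeneous_trig n p theta * r ^ n))) :
  composition_condition (linear_trig A B) (homogeneous_trig n p).
Proof.
  destruct n as [|[|m]]; [lia | lia | clear hn].
  set (P := linear_trig A B) in *; set (Q := homogeneous_trig (S (S m)) p) in *.
  set (v := linear_trig (- B) A).
  assert (HPI := PI_RGT_0).
  assert (hv : forall t, is_derive v t (P t)) by apply linear_trig_primitive.
  assert (hvper : forall t, v (t + 2 * PI) = v t).
  { intros t; unfold v, linear_trig; rewrite cos_plus, sin_plus, cos_2PI, sin_2PI; ring. }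
  assert (hvc : forall t, continuous v t)
    by (intros t; eapply is_derive_continuous, hv).
  assert (hP : forall t, continuous P t)
    by (intros t; unfold P, linear_trig;
      apply (ex_derive_continuous (fun t => A * cos t + B * sin t)); auto_derive; auto).
  assert (hQ : forall t, continuous Q t) by apply homogeneous_trig_continuous.
  destruct (homogeneous_trig_bounded (S (S m)) p) as [MQ HMQ]; fold Q in HMQ.
  set (M := Rabs A + Rabs B + MQ).
  assert (HMQ0 : 0 <= MQ) by (generalize (HMQ 0) (Rabs_pos (Q 0)); lra).
  assert (hPM : forall t, Rabs (P t) <= M)
    by (intros t; generalize (linear_trig_bound A B t); fold P; unfold M; lra).
  assert (hvM : forall t, Rabs (v t) <= M).
  { intros t; generalize (linear_trig_bound (- B) A t); rewrite Rabs_Ropp.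
    fold v; unfold M; lra. }
  assert (hQM : forall t, Rabs (Q t) <= M).
  { intros t; generalize (HMQ t) (Rabs_pos A) (Rabs_pos B); unfold M; lra. }
  assert (hv2 : v (2 * PI) = v 0) by (rewrite <- (hvper 0); f_equal; ring).
  destruct (center_integral_bound P Q v M m hP hQ hPM hQM hv hv2 hvM hcenter)
    as (a0 & C & Ha0 & Ha0M & HC).
  assert (Hmom := moments_vanish Q v M C a0 m (S (S m)) hQ hvc hQM hvM Ha0 Ha0M HC).
  destruct (split_deg_homogeneous A B (S (S m)) p hAB) as (H & K & HH & HK & E).
  fold P Q v in E.
  assert (HHc := poly_deg_lt_continuous _ _ HH).
  assert (HKc := poly_deg_lt_continuous _ _ HK).
  assert (Hcomp : forall g : R -> R, (forall x, continuous g x) ->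
    forall t, continuous (fun t => g (v t)) t)
    by (intros g Hg t; apply (continuous_comp v); auto).
  (* H has degree at most n, exactly the range of the vanishing moments. *)
  assert (H1 := RInt_poly_eq_0 Q v H 0 (2 * PI) _ _ 0 hQ hvc Hmom HH ltac:(lia)).
  set (KH := fun x => K x * H x).
  assert (HKH : forall x, continuous KH x) by (intros x; apply (continuous_mult K); auto).
  (* P is v', so substitution gives an integral of [KH] from v(0) to v(2 PI), which coincide. *)
  assert (H2 : RInt (fun t => P t * KH (v t)) 0 (2 * PI) = 0).
  { transitivity (RInt KH (v 0) (v (2 * PI))); [apply (RInt_comp KH v P 0 (2 * PI)); auto|].
    rewrite hv2; exact (RInt_point (v 0) KH). }
  (* Multiplying Q = H(v) + P K(v) by H(v) expresses the square through the two integrands just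
     treated. *)
  assert (H3 : RInt (fun t => H (v t) * H (v t)) 0 (2 * PI) = 0).
  { rewrite (RInt_extR _ (fun t => -1 * (P t * KH (v t)) + Q t * v t ^ 0 * H (v t))).
    - rewrite RInt_lin_comb.
      + rewrite H1, H2; change (-1 * 0 + 0 = 0); ring.
      + intros t; apply (continuous_mult P); auto.
      + intros t; apply (continuous_mult (fun t => Q t * v t ^ 0)); auto.
        apply (continuous_mult Q); auto; apply continuous_pow; auto.
    - intros t; rewrite E; unfold KH; simpl; ring. }
  assert (HcH : forall t, continuous (fun t => H (v t) * H (v t)) t)
    by (intros t; apply (continuous_mult (fun t => H (v t))); auto).
  exists v, (fun _ => 1), K; repeat split; auto.
  - intros t; eexists; apply hv.
  - intros x; apply continuous_const.
  - intros t; rewrite (is_derive_unique _ _ _ (hv t)); ring.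
  - intros t; rewrite (is_derive_unique _ _ _ (hv t)), E.
    (* The square vanishes only on [0, 2 PI) so far; periodicity of v moves t there. *)
    destruct (periodic_representative v (2 * PI) ltac:(lra) hvper t) as (s & Hs & <-).
    assert (H0 := RInt_nonneg_eq_0 (fun t => H (v t) * H (v t)) 0 (2 * PI) HcH
      (fun t => Rle_0_sqr (H (v t))) ltac:(lra) H3 s Hs).
    apply Rsqr_0_uniq in H0; rewrite H0; ring.
Qed.
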